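(* For every multiquiver $\Gamma$, the generalized Cartan matrix $C=(a_{ij})_{i,j\in V}$ attached to the TGW datum $(R_E,\sigma^\Gamma,t^\Gamma)$ coincides with the generalized Cartan matrix of the Dynkin diagram $D(\Gamma)$. In other words, the square formed by the assignments $\Gamma\mapsto D(\Gamma)\mapsto C$ and $\Gamma\mapsto(R_E,\sigma^\Gamma,t^\Gamma)\mapsto C$ (which are further continued by $(R_E,\sigma^\Gamma,t^\Gamma)\mapsto\mathcal{A}(\Gamma)$, the associated TGW algebra, and $C\mapsto\mathfrak{g}(C)$, the associated Kac–Moody algebra) is commutative.
   Context: $\Bbbk$ is an algebraically closed field of characteristic zero. Multiquivers. A multiquiver $\Gamma=(V,E,s,t)$ consists of sets $V$, $E$ and functions $s,t:E\to (V\times\mathbb{Z}_{>0})\cup\{\emptyset\}$ such that (no loops) if $s(e)=(u,m)$ and $t(e)=(v,n)$ then $u\ne v$; and (local finiteness) for each $v\in V$ only finitely many $e$ have $s(e)\in\{v\}\times\mathbb{Z}_{>0}$ or $t(e)\in\{v\}\times\mathbb{Z}_{>0}$. The incidence matrix is $\gamma_{ev}=n$ if $t(e)=(v,n)$, $\gamma_{ev}=-n$ if $s(e)=(v,n)$, and $\gamma_{ev}=0$ otherwise. An edge $e$ with $s(e)=\emptyset$ or $t(e)=\emptyset$ is a leaf. TGW datum of $\Gamma$: $R_E=\Bbbk[u_e\mid e\in E]$ (polynomial algebra); $\sigma^\Gamma=(\sigma_v)_{v\in V}$ with $\sigma_v$ the $\Bbbk$-automorphism of $R_E$ with $\sigma_v(u_e)=u_e-\gamma_{ev}$;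 $t^\Gamma=(t_v)_{v\in V}$, $t_v=\prod_{e\in E}u_{ev}$ with $u_{ev}=u_e(u_e+1)\cdots(u_e+\gamma_{ev}-1)$ if $\gamma_{ev}>0$, $u_{ev}=1$ if $\gamma_{ev}=0$, $u_{ev}=(u_e-1)\cdots(u_e-|\gamma_{ev}|)$ if $\gamma_{ev}<0$. Generalized Cartan matrix (GCM) of the datum: for $i,j\in V$ let $V_{ij}=\operatorname{span}_\Bbbk\{\sigma_i^k(t_j)\mid k\in\mathbb{Z}\}$ (finite-dimensional here); put $a_{ii}=2$ and $a_{ij}=1-\dim_\Bbbk V_{ij}$ for $i\neq j$; $C=(a_{ij})_{i,j\in V}$. Dynkin diagram $D(\Gamma)$: from $\Gamma$, (i) remove all leaves; (ii) forget the direction of each edge; (iii) for each pair of adjacent vertices $i,j$, replace the collection $E_{ij}$ of all edges between them by a single edge, adding multiplicities: its multiplicity at $i$ is $\sum_{e\in E_{ij}}|\gamma_{ei}|$ and its multiplicity at $j$ is $\sum_{e\in E_{ij}}|\gamma_{ej}|$. The GCM of such a diagram has $a_{ii}=2$, $a_{ij}=0$ if $i\neq j$ are not adjacent, and, if $i\ne j$ are adjacent, $-a_{ij}$ equals the multiplicity at $j$ of the edge joining $i$ and $j$ (and $-a_{ji}$ its multiplicity at $i$). *)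

(* Defs.v *)
From HB Require Import structures.
From mathcomp Require Import all_boot all_order all_algebra.
From mathcomp Require Import finmap.
From mathcomp Require Import boolp classical_sets functions cardinality fsbigop.
From mathcomp Require Import monalg.

Set Implicit Arguments.
Unset Strict Implicit.
Unset Printing Implicit Defensive.

Import GRing.Theory Num.Theory.

Local Open Scope classical_set_scope.
Local Open Scope ring_scope.

(* An endpoint is [None] for the empty set, or a vertex with a positive      *)
(* multiplicity.                                                             *)
Record multiquiver (V E : choiceType) := Multiquiver {
  source : E -> option (V * nat);
  target : E -> option (V * nat);
  source_gt0 : forall e v n, source e = Some (v, n) -> (0 < n)%N;
  target_gt0 : forall e v n, target e = Some (v, n) -> (0 < n)%N;
  no_loops : forall e u m v n,
    source e = Some (u, m) -> target e = Some (v, n) -> u <> v;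
  locally_finite : forall v : V,
    finite_set [set e | exists n : nat,
                  source e = Some (v, n) \/ target e = Some (v, n)] }.

Section Incidence.
Variables (V E : choiceType) (G : multiquiver V E).

Definition mult_at (x : option (V * nat)) (v : V) : option nat :=
  if x is Some (w, n) then if w == v then Some n else None else None.

Definition gamma (e : E) (v : V) : int :=
  if mult_at (target G e) v is Some n then n%:Z
  else if mult_at (source G e) v is Some n then - n%:Z
  else 0.

End Incidence.

Section LinearAlgebra.
Variables (k : fieldType) (M : lmodType k).

Definition lspan (S : set M) : set M :=
  [set x | exists (n : nat) (c : 'I_n -> k) (v : 'I_n -> M),
     (forall i, S (v i)) /\ x = \sum_i c i *: v i].

Definition lin_indep (n : nat) (b : 'I_n -> M) : Prop :=
  forall c : 'I_n -> k, \sum_i c i *: b i = 0 -> forall i, c i = 0.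

Definition is_basis (U : set M) (n : nat) (b : 'I_n -> M) : Prop :=
  [/\ forall i, U (b i), lin_indep b &
      forall x, U x -> exists c : 'I_n -> k, x = \sum_i c i *: b i].

(* Junk value 0 when [U] has no finite basis.                                *)
Definition dimension (U : set M) : nat :=
  xget 0%N [set n | exists b : 'I_n -> M, is_basis U b].

End LinearAlgebra.

Section AlgebraAutomorphisms.
Variables (k : fieldType) (A : algType k).

Record alg_aut := AlgAut {
  aut_fun :> {lrmorphism A -> A};
  aut_inv : A -> A;
  aut_funK : cancel aut_fun aut_inv;
  aut_invK : cancel aut_inv aut_fun }.

Definition aut_expz (f : alg_aut) (n : int) : A -> A :=
  match n with
  | Posz m => iter m f
  | Negz m => iter m.+1 (aut_inv f)
  end.

End AlgebraAutomorphisms.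

(* Only the data of a TGW datum; the Cartan matrix does not depend on the    *)
(* further axioms (commuting automorphisms, central regular elements).       *)
Record tgw_datum (k : fieldType) (V : choiceType) := TGWDatum {
  tgw_alg : algType k;
  tgw_aut : V -> alg_aut tgw_alg;
  tgw_elt : V -> tgw_alg }.

Section TGWCartan.
Variables (k : fieldType) (V : choiceType) (D : tgw_datum k V).

Definition tgw_space (i j : V) : set (tgw_alg D) :=
  lspan [set x | exists n : int, x = aut_expz (tgw_aut D i) n (tgw_elt D j)].

Definition tgw_gcm (i j : V) : int :=
  if i == j then 2 else 1 - (dimension (tgw_space i j))%:Z.

End TGWCartan.

(* [{malg k[{cmonom E}]}] is the algebra of the free commutative monoid on   *)
(* [E], i.e. the polynomial algebra k[u_e | e in E], with [E] possibly       *)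
(* infinite.                                                                 *)
Notation polyE k E := {malg k[{cmonom E}]}.

Section Substitution.
Variables (k : fieldType) (E : choiceType).

Definition uvar (e : E) : polyE k E := << ucm e >>.

Section Def.
Variable h : E -> polyE k E.

Definition subst_mon (m : {cmonom E}) : polyE k E :=
  \prod_(e <- finsupp m) h e ^+ m e.

Lemma subst_monEw (d : {fset E}) (m : {cmonom E}) : (finsupp m `<=` d)%fset ->
  subst_mon m = \prod_(e <- d) h e ^+ m e.
Proof.
move=> le; rewrite /subst_mon (big_fset_incl _ le) //= => e _.
by rewrite -cmE_eq0 => /eqP ->; rewrite expr0.
Qed.

Lemma subst_mon_is_mmorphism : mmorphism subst_mon.
Proof.
split=> [m1 m2|]; last by rewrite /subst_mon mdom1 big_seq_fset0.
rewrite (subst_monEw (m := m1) (fsubsetUl _ (finsupp m2))).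
rewrite (subst_monEw (m := m2) (fsubsetUr (finsupp m1) _)).
rewrite /subst_mon mdomD -big_split /=; apply: eq_bigr => e _.
by rewrite cmM exprD.
Qed.

HB.instance Definition _ :=
  isMultiplicative.Build {cmonom E} (polyE k E) subst_mon subst_mon_is_mmorphism.

(* The endomorphism of k-algebras sending each variable u_e to h e.          *)
Definition subst : polyE k E -> polyE k E := mmap (@malgC _ _) subst_mon.

HB.instance Definition _ := GRing.RMorphism.copy subst (mmap (@malgC _ _) subst_mon).

Lemma subst_is_scalable : scalable subst.
Proof. by move=> c g; rewrite /subst mmapZ /= mul_malgC. Qed.

HB.instance Definition _ :=
  GRing.isScalable.Build k (polyE k E) (polyE k E) *:%R subst subst_is_scalable.

Lemma substE e : subst (uvar e) = h e.
Proof.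
rewrite /subst mmapU /= -[mkmalgU _ _]/(1%:MP) mpolyC1E mul1r.
by rewrite /subst_mon mdomU big_seq_fset1 cmUU expr1.
Qed.

End Def.

Lemma polyE_ext (f g : {lrmorphism polyE k E -> polyE k E}) :
  (forall e, f (uvar e) = g (uvar e)) -> f =1 g.
Proof.
move=> fg p.
have fgm (m : {cmonom E}) : f << m >> = g << m >>.
  have [n] := ubnP (mdeg m); elim: n m => // n IHn m lemn.
  have [m1|[e em]] := fset_0Vmem (finsupp m).
    suff -> : m = mone by rewrite (rmorph1 f) (rmorph1 g).
    by apply/eqP/cmP => i; rewrite cm1; apply/eqP; rewrite cmE_eq0 m1.
  have Dm : m = mmul (ucm e) (divcm m (ucm e)).
    apply/eqP/cmP => i; rewrite cmM divcmE ucmE subnKC //.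
    by case: eqP => // <-; rewrite lt0n cmE_neq0.
  have Dp : << m >> = uvar e * << divcm m (ucm e) >> :> polyE k E.
    by rewrite /uvar malgM_def fgmulUU mulr1 -Dm.
  have IHm : f << divcm m (ucm e) >> = g << divcm m (ucm e) >>.
    apply: IHn; move: lemn.
    by rewrite [X in mdeg X]Dm mdegM mdegU add1n.
  have fM x y : f (x * y) = f x * f y by exact: rmorphM.
  have gM x y : g (x * y) = g x * g y by exact: rmorphM.
  rewrite Dp fM gM; exact: (congr2 *%R (fg e) IHm).
rewrite [p]monalgE !raddf_sum; apply: eq_bigr => m _.
have -> : << p@_m *g m >> = p@_m *: << m >> :> polyE k E.
  by rewrite -mul_malgC malgM_def fgmulUU mulr1 mul1m.
have fZ c x : f (c *: x) = c *: f x by exact: linearZ.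
have gZ c x : g (c *: x) = c *: g x by exact: linearZ.
by rewrite /= fZ gZ; exact: (congr1 ( *:%R _) (fgm m)).
Qed.

Lemma subst_shift h e (c : k) : subst h (uvar e + c%:A) = h e + c%:A.
Proof.
have -> : subst h (uvar e + c%:A) = subst h (uvar e) + subst h c%:A.
  exact: rmorphD.
by rewrite (substE h e) linearZ; congr (_ + _ *: _); exact: rmorph1.
Qed.

Lemma shift_substK (a : E -> k) :
  cancel (subst (fun e => uvar e + (a e)%:A)) (subst (fun e => uvar e - (a e)%:A)).
Proof.
move=> p; pose f := subst (fun e => uvar e + (a e)%:A).
pose g := subst (fun e => uvar e - (a e)%:A).
apply: (@polyE_ext (g \o f) idfun) => e.
have fe : f (uvar e) = uvar e + (a e)%:A := substE _ e.
have ge : g (uvar e + (a e)%:A) = uvar e - (a e)%:A + (a e)%:A.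
  exact: subst_shift.
exact: (etrans (congr1 g fe) (etrans ge (subrK _ _))).
Qed.

Lemma shift_substVK (a : E -> k) :
  cancel (subst (fun e => uvar e - (a e)%:A)) (subst (fun e => uvar e + (a e)%:A)).
Proof.
move=> p; pose f := subst (fun e => uvar e - (a e)%:A).
pose g := subst (fun e => uvar e + (a e)%:A).
apply: (@polyE_ext (g \o f) idfun) => e.
have fe : f (uvar e) = uvar e - (a e)%:A := substE _ e.
have ge : g (uvar e - (a e)%:A) = uvar e + (a e)%:A - (a e)%:A.
  by rewrite -scaleNr; exact: subst_shift.
exact: (etrans (congr1 g fe) (etrans ge (addrK _ _))).
Qed.

(* The automorphism of k[u_e | e in E] with u_e |-> u_e - a_e.               *)
Definition shift_aut (a : E -> k) : alg_aut (polyE k E) :=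
  AlgAut (@shift_substVK a) (@shift_substK a).

End Substitution.

Section QuiverDatum.
Variables (k : fieldType) (V E : choiceType) (G : multiquiver V E).

Definition quiver_aut (v : V) : alg_aut (polyE k E) :=
  shift_aut (fun e => (gamma G e v)%:~R).

Definition uev (e : E) (v : V) : polyE k E :=
  let g := gamma G e v in
  if 0 < g then \prod_(0 <= m < `|g|%N) (uvar k e + m%:R)
  else if g < 0 then \prod_(1 <= m < `|g|%N.+1) (uvar k e - m%:R)
  else 1.

(* The product over all e in E is finite: u_ev = 1 unless e is incident to v. *)
Definition quiver_elt (v : V) : polyE k E :=
  \big[*%R/1]_(e \in [set: E]) uev e v.

Definition quiver_datum : tgw_datum k V :=
  TGWDatum quiver_aut quiver_elt.

End QuiverDatum.

(* [dg_mult i j] is the multiplicity at [i] of the edge joining [i] and [j]; *)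
(* it is meaningless if [i] and [j] are not adjacent.                        *)
Record diagram (V : choiceType) := Diagram {
  dg_adj : V -> V -> Prop;
  dg_mult : V -> V -> nat;
  dg_adj_sym : forall i j, dg_adj i j -> dg_adj j i;
  dg_adj_irr : forall i, ~ dg_adj i i;
  dg_mult_gt0 : forall i j, dg_adj i j -> (0 < dg_mult i j)%N }.

Definition diagram_gcm (V : choiceType) (D : diagram V) (i j : V) : int :=
  if i == j then 2
  else if `[< dg_adj D i j >] then - (dg_mult D j i)%:Z
  else 0.

Section Dynkin.
Variables (V E : choiceType) (G : multiquiver V E).

Definition leaf (e : E) : Prop := source G e = None \/ target G e = None.

Definition from_to (e : E) (i j : V) : Prop :=
  exists m n : nat, source G e = Some (i, m) /\ target G e = Some (j, n).

Definition edges_between (i j : V) : set E :=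
  [set e | ~ leaf e /\ (from_to e i j \/ from_to e j i)].

Definition dynkin_adj (i j : V) : Prop := exists e, edges_between i j e.

Definition dynkin_mult (i j : V) : nat :=
  \big[addn/0%N]_(e \in edges_between i j) `|gamma G e i|%N.

Lemma dynkin_adj_sym i j : dynkin_adj i j -> dynkin_adj j i.
Proof. by move=> [e [le ije]]; exists e; split=> //; case: ije; [right|left]. Qed.

Lemma dynkin_adj_irr i : ~ dynkin_adj i i.
Proof.
by move=> [e [_ [] [m [n [se te]]]]]; apply: (no_loops se te).
Qed.

Lemma edges_between_finite i j : finite_set (edges_between i j).
Proof.
apply: sub_finite_set (locally_finite G i) => e /= [_].
by case=> [] [m [n [se te]]]; [exists m; left|exists n; right].
Qed.

Lemma edges_between_gamma i j e : edges_between i j e -> gamma G e i != 0.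
Proof.
move=> [_ [] [m [n [se te]]]]; rewrite /gamma /mult_at se te eqxx.
  have /eqP/negPf ne := no_loops se te; rewrite eq_sym in ne.
  by rewrite ne oppr_eq0 -lt0n (source_gt0 se).
by rewrite -lt0n (target_gt0 te).
Qed.

Lemma dynkin_mult_gt0 i j : dynkin_adj i j -> (0 < dynkin_mult i j)%N.
Proof.
move=> [e ije]; rewrite /dynkin_mult.
have g0 : (0 < `|gamma G e i|)%N by rewrite absz_gt0 (edges_between_gamma ije).
set s := finite_support _ _ _.
have es : e \in s.
  rewrite /s in_finite_support; last first.
    exact: sub_finite_set (@edges_between_finite i j).
  by rewrite inE; split=> //=; apply/eqP; rewrite -lt0n.
by rewrite (big_rem e) //= addn_gt0 g0.
Qed.

Definition dynkin : diagram V :=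
  Diagram dynkin_adj_sym dynkin_adj_irr dynkin_mult_gt0.

End Dynkin.

(* Main.v *)
(* Along the orbit of [sigma_i], every factor [u_e + c] of [t_j] becomes       *)
(* [u_e + c - n gamma_ei], so [sigma_i^n t_j] is a polynomial in [n] of degree *)
(* [d], the sum of [|gamma_ej|] over the edges with [gamma_ei != 0].  Lagrange *)
(* interpolation at [0, ..., d] (a Vandermonde inverse) shows that the [d + 1] *)
(* elements [sigma_i^m t_j], [m <= d], span [V_ij].  They are independent      *)
(* because a suitable specialisation of the [u_e] maps them to the translates  *)
(* [p (x - m)] of a univariate polynomial [p] of degree exactly [d].  Hence    *)
(* [dim V_ij = d + 1] and [a_ij = - d], the multiplicity at [j].               *)

Require Import Defs.
From mathcomp Require Import all_boot all_order all_algebra.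
From mathcomp Require Import boolp classical_sets monalg.
From mathcomp Require Import finmap functions cardinality fsbigop ring.

Set Implicit Arguments.
Unset Strict Implicit.
Unset Printing Implicit Defensive.

Import Order.TTheory GRing.Theory Num.Theory.

Local Open Scope classical_set_scope.
Local Open Scope ring_scope.

(** Let [i != j]. Then [t_j] is a product of linear factors [u_e + c], [|gamma_ej|] of them for each
    edge [e] ([quiver_eltE]), and [sigma_i^n] subtracts [n * gamma_ei] from each. A factor moves
    only if [gamma_ei] is nonzero; an edge meeting both [i] and [j] joins them and is no leaf
    ([edges_betweenP]), so the number [d] of moving factors is the multiplicity at [j]
    ([count_factors]). The orbit is thus polynomial in [n] of degree at most [d], and it spans
    exactly [d + 1] dimensions ([dimension_shift_orbit]): no more, by interpolation
    ([polynomial_in_span_nat]); no fewer, because translates of a degree-[d] polynomial by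
    [0, ..., d] are independent in characteristic zero ([poly_translates_free]). *)

(** * Well-definedness of dimension *)

Section Dimension.
Variables (k : fieldType) (M : lmodType k).

Lemma lin_indep_leq (n m : nat) (b : 'I_n -> M) (b' : 'I_m -> M) :
  lin_indep b' -> (forall i, exists c : 'I_n -> k, b' i = \sum_j c j *: b j) ->
  (m <= n)%N.
Proof.
move=> b'free /choice[c b'E]; pose C := \matrix_(i < m, j < n) c i j.
rewrite leqNgt; apply/negP => ltnm.
(* If [n < m], the coefficient matrix has a nonzero left kernel, each row of which is a linear
   relation among the [b' i]. *)
have : kermx C != 0.
  by rewrite -mxrank_eq0 mxrank_ker subn_eq0 -ltnNge (leq_ltn_trans (rank_leq_col C)).
case/negP; apply/eqP/row_matrixP => r; rewrite row0; apply/rowP => i.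
rewrite mxE [RHS]mxE; move: i; apply: b'free.
under eq_bigr do rewrite b'E scaler_sumr.
rewrite exchange_big /= big1 // => j _.
under eq_bigr do rewrite scalerA.
rewrite -scaler_suml.
have /matrixP/(_ r j) := mulmx_ker C; rewrite !mxE => rC0.
suff -> : \sum_i kermx C r i * c i j = 0 by rewrite scale0r.
by rewrite -[RHS]rC0; apply: eq_bigr => i _; rewrite [C i j]mxE.
Qed.

Lemma dimension_basis (U : set M) n (b : 'I_n -> M) :
  is_basis U b -> dimension U = n.
Proof.
move=> [Ub bfree bgen]; apply: xget_unique; first by exists b.
move=> m [b' [Ub' b'free b'gen]]; apply/eqP; rewrite eqn_leq.
apply/andP; split.
  exact: lin_indep_leq b'free (fun i => bgen _ (Ub' i)).
exact: lin_indep_leq bfree (fun i => b'gen _ (Ub i)).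
Qed.

End Dimension.

(** * Vandermonde systems and polynomial translates in characteristic zero *)

Section CharacteristicZero.
Variables (k : fieldType) (hchar : [pchar k] =i pred0).

Lemma natr_inj_pchar0 : injective (fun n : nat => n%:R : k).
Proof.
move=> m n; wlog lemn : m n / (m <= n)%N.
  by move=> W; case/orP: (leq_total m n) => [|le eq]; [exact: W|exact/esym/W].
move=> /esym/eqP; rewrite -subr_eq0 -natrB // ((pcharf0P k).1 hchar).
by rewrite subn_eq0 => lenm; apply/eqP; rewrite eqn_leq lemn.
Qed.

Lemma intr_eq0_pchar0 (z : int) : ((z%:~R : k) == 0) = (z == 0).
Proof.
by case: z => n; rewrite ?NegzE ?rmorphN ?oppr_eq0 /= ((pcharf0P k).1 hchar).
Qed.

Lemma poly0_nat_roots (p : {poly k}) : (forall n : nat, p.[n%:R] = 0) -> p = 0.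
Proof.
move=> p0; apply/eqP/negPn/negP => pn0.
have : (size [seq n%:R : k | n <- iota 0 (size p)] < size p)%N.
  apply: max_poly_roots => //; first by apply/allP => _ /mapP[n _ ->]; apply/eqP.
  by rewrite map_inj_uniq ?iota_uniq //; exact: natr_inj_pchar0.
by rewrite size_map size_iota ltnn.
Qed.

Lemma exists_nat_nonroot (p : {poly k}) : p != 0 -> exists n : nat, p.[n%:R] != 0.
Proof.
move=> pn0; apply: contrapT => nex; case/negP: pn0; apply/eqP.
apply: poly0_nat_roots => n; apply/eqP/negPn/negP => pn; by apply: nex; exists n.
Qed.

Lemma Vandermonde_nat_unit n :
  Vandermonde n (\row_(j < n) (j%:R : k)) \in unitmx.
Proof.
rewrite unitmxE det_Vandermonde unitfE; apply/prodf_neq0 => i _.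
apply/prodf_neq0 => j ltij; rewrite !mxE subr_eq0; apply/eqP => /natr_inj_pchar0.
by move=> eqij; rewrite eqij ltnn in ltij.
Qed.

Lemma moments_eq0 d (c : 'I_d -> k) :
  (forall l, (l < d)%N -> \sum_m c m * m%:R ^+ l = 0) -> forall m, c m = 0.
Proof.
move=> c0 m; pose W := Vandermonde d (\row_(j < d) (j%:R : k)).
have /rowP/(_ m) : (\col_j c j)^T = 0 :> 'rV_d.
  have /(congr1 (mulmx^~ (invmx W^T))) : (\col_j c j)^T *m W^T = 0.
    rewrite -trmx_mul; apply/trmx_inj; rewrite trmxK trmx0.
    apply/colP => l; rewrite !mxE -[RHS](c0 _ (ltn_ord l)).
    by apply: eq_bigr => i _; rewrite !mxE mulrC.
  by rewrite mulmxK ?mul0mx // unitmx_tr Vandermonde_nat_unit.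
by rewrite !mxE.
Qed.

(** The [c m] are the Lagrange weights that express evaluation at [x], in degree below [d], through
    the values at [0, ..., d - 1]. *)
Lemma exists_moments d (x : k) : exists c : 'I_d -> k,
  forall l, (l < d)%N -> \sum_m c m * m%:R ^+ l = x ^+ l.
Proof.
pose W := Vandermonde d (\row_(j < d) (j%:R : k)).
pose C := invmx W *m (\col_(l < d) x ^+ l); exists (fun m => C m 0) => l ltl.
have /colP/(_ (Ordinal ltl)) : W *m C = \col_(l < d) x ^+ l.
  by rewrite mulmxA mulmxV ?mul1mx ?Vandermonde_nat_unit.
rewrite !mxE => <-; apply: eq_bigr => i _.
by rewrite [W _ _]mxE [X in _ = X ^+ _ * _]mxE mulrC.
Qed.

(* Taylor's formula writes the combination as [\sum_l mu_l p^`N(l)] with      *)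
(* [mu_l] the signed moments of [c]; degrees force all [mu_l] to vanish.      *)
Lemma poly_translates_free (p : {poly k}) (c : 'I_(size p) -> k) :
  (forall n : nat, \sum_m c m * p.[n%:R - m%:R] = 0) -> forall m, c m = 0.
Proof.
move=> cp0; pose mu l := \sum_m c m * (- m%:R) ^+ l.
have q0 : \sum_(l < size p) mu l *: p^`N(l) = 0.
  apply: poly0_nat_roots => n; rewrite -[RHS](cp0 n) horner_sum.
  under [RHS]eq_bigr => m _ do
    rewrite (nderiv_taylor p (mulrC n%:R (- m%:R))) mulr_sumr.
  rewrite exchange_big; apply: eq_bigr => l _ /=.
  rewrite hornerZ mulr_suml; apply: eq_bigr => m _.
  by rewrite -mulrA [_ ^+ _ * _]mulrC.
have mu0 l : (l < size p)%N -> mu l = 0.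
  elim/ltn_ind: l => l IHl ltl.
  (* In this degree only the term [l] survives: smaller indices vanish by induction, larger ones
     have too small a degree. What remains is [mu l] times the leading coefficient of [p] times a
     nonzero binomial. *)
  have /(congr1 (fun q : {poly k} => q`_((size p).-1 - l))) := q0.
  rewrite coef0 coef_sum (bigD1 (Ordinal ltl)) //= coefZ coef_nderivn.
  have lel : (l <= (size p).-1)%N by rewrite -ltnS prednK // (leq_ltn_trans _ ltl).
  rewrite subnKC // big1 ?addr0 => [|l' nel'].
    move/eqP; rewrite mulf_eq0 => /orP[/eqP //|]; rewrite -mulr_natr mulf_eq0.
    rewrite ((pcharf0P k).1 hchar) -lead_coefE lead_coef_eq0 => /orP[/eqP p0|].
      by move: ltl; rewrite p0 size_poly0.
    by rewrite eqn0Ngt bin_gt0 lel.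
  rewrite coefZ coef_nderivn; case: (ltngtP l' l) => [lt|lt|eq].
  - by rewrite IHl ?mul0r.
  - rewrite nth_default ?mul0rn ?mulr0 //.
    rewrite -[X in (X <= _)%N](prednK (leq_ltn_trans (leq0n _) ltl)).
    by rewrite -{1}(subnKC lel) ltn_add2r.
  - by case/eqP: nel'; apply: val_inj.
apply: moments_eq0 => l ltl; have := mu0 l ltl; rewrite /mu.
under eq_bigr do rewrite exprNn mulrCA.
by rewrite -mulr_sumr => /eqP; rewrite mulf_eq0 signr_eq0 => /eqP.
Qed.

End CharacteristicZero.

(** * Products of linear factors as polynomials in the shift *)

Section PolynomialOrbit.
Variables (k : fieldType) (A : algType k) (I : Type).
Variables (a : I -> A) (g : I -> k).

Lemma prod_linear_polynomial (s : seq I) : exists w : nat -> A, forall x : k,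
  \prod_(i <- s) (a i - (x * g i)%:A) =
  \sum_(l < (count (fun i => g i != 0) s).+1) x ^+ l *: w l.
Proof.
elim: s => [|i s [w wE]].
  by exists (fun=> 1) => x; rewrite big_nil big_ord1 expr0 scale1r.
have [gi0|gin0] := eqVneq (g i) 0.
  exists (fun l => a i * w l) => x; rewrite !big_cons /= gi0 eqxx add0n wE.
  rewrite mulr0 scale0r subr0 mulr_sumr; apply: eq_bigr => l _.
  by rewrite scalerAr.
set d := count _ s in wE *.
(* Multiplication by [a i - x g_i] on coefficients; [w] is unconstrained beyond [d], hence the
   cut-off. *)
exists (fun l => (if (l <= d)%N then a i * w l else 0) -
                 (if l is l'.+1 then g i *: w l' else 0)) => x.
rewrite !big_cons /= gin0 add1n wE -/d mulrBl.
under [RHS]eq_bigr do rewrite scalerBr.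
rewrite sumrB; congr (_ - _).
  rewrite [RHS]big_ord_recr /= ltnn scaler0 addr0 mulr_sumr; apply: eq_bigr => l _.
  by rewrite -ltnS ltn_ord scalerAr.
rewrite [RHS]big_ord_recl /= scaler0 add0r mulr_sumr; apply: eq_bigr => l _.
by rewrite mulr_algl !scalerA exprS /bump /= mulrAC.
Qed.

End PolynomialOrbit.

Lemma polynomial_in_span_nat (k : fieldType) (hchar : [pchar k] =i pred0)
    (A : lmodType k) d (w : nat -> A) (x : k) :
  exists c : 'I_d -> k, \sum_(l < d) x ^+ l *: w l =
    \sum_(m < d) c m *: \sum_(l < d) m%:R ^+ l *: w l.
Proof.
have [c cE] := exists_moments hchar d x; exists c.
under [RHS]eq_bigr do rewrite scaler_sumr.
rewrite exchange_big; apply: eq_bigr => l _ /=.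
under [RHS]eq_bigr do rewrite scalerA.
by rewrite -scaler_suml cE.
Qed.

Lemma size_prod_linear (k : fieldType) (I : Type) (g b : I -> k) (s : seq I) :
  all (fun i => b i != 0) s ->
  size (\prod_(i <- s) (g i *: 'X + (b i)%:P)) = (count (fun i => g i != 0) s).+1.
Proof.
elim: s => [|i s IHs] /=; first by rewrite big_nil size_poly1.
move=> /andP[bi bs]; rewrite !big_cons.
have sz : size (g i *: 'X + (b i)%:P) = (g i != 0).+1.
  have [->|gi] := eqVneq (g i) 0; first by rewrite scale0r add0r size_polyC bi.
  by rewrite size_polyDl size_scale ?size_polyX // (leq_ltn_trans (size_polyC_leq1 _)).
by rewrite size_mul; [by rewrite sz IHs // addnS| |]; rewrite -size_poly_eq0 ?sz ?IHs.
Qed.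

(** * Dimension of the orbit of a shift automorphism *)

(* Here [A] is an algebra with the universal property of the polynomial       *)
(* algebra on the generators [u e], [ev h] being the evaluation [u e |-> h e]; *)
(* rewriting under the concrete [subst] makes unification diverge.            *)
Section ShiftOrbit.
Variables (k : fieldType) (hchar : [pchar k] =i pred0) (E : Type).
Variables (A : algType k) (u : E -> A) (ev : (E -> A) -> {lrmorphism A -> A}).
Hypothesis evE : forall h e, ev h (u e) = h e.
Hypothesis generator_ext : forall f1 f2 : {lrmorphism A -> A},
  (forall e, f1 (u e) = f2 (u e)) -> f1 =1 f2.

Lemma ev_comp (h h' : E -> A) (p : A) :
  ev h (ev h' p) = ev (fun e => ev h (h' e)) p.
Proof. by apply: (@generator_ext (ev h \o ev h')) => e /=; rewrite !evE. Qed.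

Lemma eq_ev (h h' : E -> A) : h =1 h' -> ev h =1 ev h'.
Proof. by move=> /funext ->. Qed.

Lemma ev_id (p : A) : ev u p = p.
Proof. by apply: (generator_ext (f2 := idfun)) => e /=; rewrite evE. Qed.

Lemma ev_affine h e (x : k) : ev h (u e + x%:A) = h e + x%:A.
Proof. by rewrite rmorphD /= evE rmorph_alg. Qed.

Variables (g : E -> k) (f : alg_aut A).
Hypothesis f_shift : forall e, f (u e) = u e - (g e)%:A.

Let trans (x : k) (e : E) : A := u e - (x * g e)%:A.

(** The substitutions [trans x] compose additively in [x], and [f] and its inverse are those at [1]
    and [- 1]. *)
Lemma aut_expz_shift (n : int) (p : A) : aut_expz f n p = ev (trans n%:~R) p.
Proof.
have step x y q : ev (trans x) (ev (trans y) q) = ev (trans (x + y)) q.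
  rewrite ev_comp; apply: eq_ev => e.
  rewrite /trans -scaleNr ev_affine -addrA -scaleNr -scalerDl -opprD -mulrDl.
  by rewrite scaleNr.
have trans0 q : ev (trans 0) q = q.
  by rewrite -[RHS]ev_id; apply: eq_ev => e; rewrite /trans mul0r scale0r subr0.
have fE q : f q = ev (trans 1) q.
  by apply: generator_ext => e; rewrite evE f_shift /trans mul1r.
have fVE q : aut_inv f q = ev (trans (- 1)) q.
  by apply: (canLR (aut_funK f)); rewrite fE step subrr trans0.
case: n => n.
  elim: n => [|n IHn]; first by rewrite trans0.
  by rewrite /= in IHn *; rewrite IHn fE step [Posz n.+1]intS intrD.
rewrite /= NegzE; elim: n => [|n IHn]; first exact: fVE.
by rewrite iterS IHn fVE step [Posz n.+2]intS opprD intrD.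
Qed.

Variables (I : Type) (v : I -> E) (c : I -> k) (s : seq I).

Let t : A := \prod_(i <- s) (u (v i) + (c i)%:A).

Let ev_t h : ev h t = \prod_(i <- s) (h (v i) + (c i)%:A).
Proof. by rewrite rmorph_prod; apply: eq_bigr => i _; exact: ev_affine. Qed.

(* Specialising every [u e] to [x * g e + y] turns [f] into [x |-> x - 1] and  *)
(* [t] into a univariate polynomial in [x] whose degree is the claimed count. *)
Lemma dimension_shift_orbit :
  dimension (lspan [set x | exists n : int, x = aut_expz f n t]) =
  (count (fun i => g (v i) != 0)%R s).+1.
Proof.
set d := count _ s.
have orbE (n : int) : aut_expz f n t =
    \prod_(i <- s) (u (v i) + (c i)%:A - (n%:~R * g (v i))%:A).
  rewrite aut_expz_shift ev_t; apply: eq_bigr => i _.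
  by rewrite /trans addrAC.
have [w wE] := prod_linear_polynomial (fun i => u (v i) + (c i)%:A)
                 (fun i => g (v i)) s.
pose b (m : 'I_d.+1) := aut_expz f m t.
apply: (@dimension_basis _ _ _ _ b); split.
- move=> m; exists 1%N, (fun=> 1), (fun=> b m).
  by split; [move=> _; exists m|rewrite big_ord1 scale1r].
(* The offset [y] keeps the factors with [g (v i) = 0] from specialising to zero, so that [p] has
   degree exactly [d]. *)
- have [y yP] : exists y : k, all (fun i => y + c i != 0) s.
    have : \prod_(i <- s) ('X + (c i)%:P) != 0.
      elim: (s) => [|i r IHr]; first by rewrite big_nil oner_eq0.
      by rewrite big_cons mulf_neq0 // -size_poly_eq0 size_XaddC.
    move=> /(exists_nat_nonroot hchar)[n]; rewrite horner_prod => pn0.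
    exists n%:R; elim: (s) pn0 => //= i r IHr.
    by rewrite big_cons mulf_eq0 negb_or !hornerE => /andP[-> /IHr].
  pose p := \prod_(i <- s) (g (v i) *: 'X + (y + c i)%:P).
  have szp : size p = d.+1 by exact: size_prod_linear.
  have evpE (x : k) (m : nat) :
      ev (fun e => (x * g e + y)%:A) (aut_expz f m t) = (p.[x - m%:R])%:A.
    rewrite aut_expz_shift ev_comp ev_t horner_prod.
    rewrite -[RHS]/(in_alg A _) rmorph_prod; apply: eq_bigr => i _ /=.
    rewrite /trans -scaleNr ev_affine -!scalerDl hornerD hornerZ hornerX hornerC -pmulrn.
    by congr (_ *: _); ring.
  rewrite /lin_indep /b -szp => a ab0.
  apply: (poly_translates_free hchar) => n.
  have /(congr1 (ev (fun e => (n%:R * g e + y)%:A))) := ab0.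
  rewrite rmorph0 rmorph_sum /=.
  under eq_bigr do rewrite linearZ /= evpE scalerA.
  by rewrite -scaler_suml => /eqP; rewrite scaler_eq0 oner_eq0 orbF => /eqP.
- have spanE (n : int) : exists c' : 'I_d.+1 -> k,
      aut_expz f n t = \sum_m c' m *: b m.
    have [c' c'E] := polynomial_in_span_nat hchar d.+1 w n%:~R.
    exists c'; rewrite orbE wE c'E; apply: eq_bigr => m _.
    by rewrite /b orbE wE.
  move=> x [n [a [z [/choice[m zE] ->]]]].
  have [c' c'E] := choice spanE.
  exists (fun l => \sum_i a i * c' (m i) l).
  under eq_bigr do rewrite zE c'E scaler_sumr.
  rewrite exchange_big; apply: eq_bigr => l _ /=.
  by rewrite scaler_suml; apply: eq_bigr => i _; rewrite scalerA.
Qed.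

End ShiftOrbit.

(** * Linear factors of [t_j] and Dynkin multiplicities *)

Section QuiverCartan.
Variables (k : fieldType) (V E : choiceType) (G : multiquiver V E).

Lemma gamma_neq0 e v : gamma G e v != 0 ->
  exists n, source G e = Some (v, n) \/ target G e = Some (v, n).
Proof.
have mult_atP x n : mult_at x v = Some n -> x = Some (v, n).
  by case: x => [[w m]|] //=; case: eqP => // -> [->].
rewrite /gamma; case te: mult_at => [n|]; first by exists n; right; exact: mult_atP.
case se: mult_at => [n|]; first by exists n; left; exact: mult_atP.
by rewrite eqxx.
Qed.

Lemma edges_betweenP i j e : i != j ->
  edges_between G i j e <-> gamma G e i != 0 /\ gamma G e j != 0.
Proof.
move=> /eqP neij; split=> [ije|[/gamma_neq0[m si] /gamma_neq0[n sj]]].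
  split; first exact: edges_between_gamma ije.
  by apply: (@edges_between_gamma _ _ _ j i); case: ije => ? []; split; auto.
case: si sj => [si|ti] [sj|tj].
- by case: neij; move: sj; rewrite si => -[].
- split; first by case; rewrite ?si ?tj.
  by left; exists m, n.
- split; first by case; rewrite ?sj ?ti.
  by right; exists n, m.
- by case: neij; move: tj; rewrite ti => -[].
Qed.

Let incident (v : V) : {fset E} :=
  fset_set [set e | exists n : nat,
              source G e = Some (v, n) \/ target G e = Some (v, n)].

Let notin_incident v e : e \notin incident v -> gamma G e v = 0.
Proof.
move=> einc; apply/eqP/negPn/negP => /gamma_neq0 env; case/negP: einc.
by rewrite /incident in_fset_set; [exact: mem_set|exact: (locally_finite G v)].
Qed.

Lemma dynkin_multE i j : i != j -> dynkin_mult G j i =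
  (\sum_(e <- incident j) if gamma G e i != 0%R then `|gamma G e j|%N else 0)%N.
Proof.
move=> neij; rewrite /dynkin_mult fsbig_mkcond (@fsbigTE _ _ _ _ (incident j)).
  rewrite eq_sym in neij; apply: eq_bigr => e _; rewrite /patch.
  case: ifPn => [/set_mem/(edges_betweenP _ neij)[_ ->] //|/negP nje].
  case: ifP => // gi; have [->|gj] := eqVneq (gamma G e j) 0; first by [].
  by case: nje; apply/mem_set/edges_betweenP.
by move=> e /notin_incident g0; rewrite /patch g0 absz0 if_same.
Qed.

(** Both signs are indexed from [0], so the negative constants are [-(m + 1)]. *)
Let factor_const (v : V) (x : E * nat) : k :=
  if 0 < gamma G x.1 v then x.2%:R else - x.2.+1%:R.

Lemma uevE e v : uev k G e v =
  \prod_(m <- iota 0 `|gamma G e v|%N) (uvar k e + (factor_const v (e, m))%:A).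
Proof.
rewrite /uev /factor_const /=; case: ltgtP => [g0|g0|<-].
- by rewrite /index_iota subn0; apply: eq_bigr => m _; rewrite scaler_nat.
- rewrite big_add1 /= /index_iota subn0; apply: eq_bigr => m _.
  by rewrite scaleNr scaler_nat.
- by rewrite absz0 big_nil.
Qed.

Let factors (v : V) : seq (E * nat) :=
  [seq (e, m) | e <- incident v, m <- iota 0 `|gamma G e v|%N].

Lemma quiver_eltE v : quiver_elt k G v =
  \prod_(x <- factors v) (uvar k x.1 + (factor_const v x)%:A).
Proof.
rewrite /quiver_elt (@fsbigTE _ _ _ _ (incident v)) => [|e /notin_incident g0].
  by rewrite big_allpairs_dep; apply: eq_bigr => e _; exact: uevE.
by rewrite uevE g0 big_nil.
Qed.

Lemma count_factors i j : i != j ->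
  count (fun x => gamma G x.1 i != 0)%R (factors j) = dynkin_mult G j i.
Proof.
move=> neij; rewrite dynkin_multE // -sum1_count big_mkcond big_allpairs_dep.
apply: eq_bigr => e _ /=; case: ifP => _; last by rewrite big1.
by rewrite sum1_size size_iota.
Qed.

Lemma dimension_tgw_space (hchar : [pchar k] =i pred0) i j : i != j ->
  dimension (tgw_space (D := quiver_datum k G) i j) = (dynkin_mult G j i).+1.
Proof.
move=> neij; rewrite /tgw_space /= quiver_eltE -(count_factors neij).
(* In characteristic zero a nonzero incidence number stays nonzero in [k]. *)
have -> : count (fun x => gamma G x.1 i != 0) (factors j) =
    count (fun x => (gamma G x.1 i)%:~R != 0 :> k) (factors j).
  by apply: eq_count => x /=; rewrite intr_eq0_pchar0.
exact: (@dimension_shift_orbit k hchar E _ (@uvar k E)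
  (fun h => subst h) (@substE k E) (@polyE_ext k E)
  (fun e => (gamma G e i)%:~R) (quiver_aut k G i) (fun e => substE _ e)).
Qed.

End QuiverCartan.

Theorem theorem5p3 (k : closedFieldType) (hchar : [pchar k]%R =i pred0)
    (V E : choiceType) (G : multiquiver V E) (i j : V) :
  tgw_gcm (quiver_datum k G) i j = diagram_gcm (dynkin G) i j.
Proof.
rewrite /tgw_gcm /diagram_gcm; case: eqVneq => // neij.
rewrite (dimension_tgw_space G hchar neij) intS opprD addrA subrr add0r.
(* For non-adjacent vertices the multiplicity is an empty sum, which gives the entry [0]. *)
case: asboolP => //= nadj; rewrite /dynkin_mult fsbig1 // => e eji.
by case: nadj; apply: dynkin_adj_sym; exists e.
Qed.
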